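(* Let $\mathcal{G}=(\mathcal{V},\mathcal{E})$ be a finite, simple, connected, undirected graph and let $v\in\mathcal{V}$ be a vertex of degree $N\ge 1$. Put $\tau_s=\frac{\pi}{2\sqrt{N}}$. Suppose that there exists a chiral Hamiltonian $\mathbf{H}_s$ on $\mathcal{G}$ generating a swift chiral quantum walk starting from $v$. Then this walk is the fastest at leaving $v$ among all chiral quantum walks on $\mathcal{G}$ starting from $v$ (with generic diagonal entries of the chiral Hamiltonian), in the following sense: (i) at time $\tau_s$ it has evolved to a state orthogonal to $\underline{e}_v$, i.e. $\underline{e}_v^\dagger e^{-i\mathbf{H}_s\tau_s}\underline{e}_v=0$; (ii) $\tau_s$ is the shortest quantum speed limit among all chiral evolutions starting from $v$ on $\mathcal{G}$: $\tau_{QSL}(\mathbf{H}_s)=\tau_s\le \tau_{QSL}(\mathbf{H})$ for every chiral Hamiltonian $\mathbf{H}$ on $\mathcal{G}$; in particular, if $\mathbf{H}$ is any chiral Hamiltonian on $\mathcal{G}$ and $t>0$ satisfies $\underline{e}_v^\dagger e^{-i\mathbf{H}t}\underline{e}_v=0$, then $t\ge\tau_s$.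
   Context: Let $\mathcal{G}$ be a finite simple undirected graph with $n$ vertices and adjacency matrix $\mathbf{A}$. A chiral adjacency matrix on $\mathcal{G}$ is an $n\times n$ hermitian matrix $\tilde{\mathbf{A}}$ such that $\tilde{\mathbf{A}}_{jk}$ is a complex number of modulus $1$ whenever $\mathbf{A}_{jk}=1$, and $\tilde{\mathbf{A}}_{jk}=0$ whenever $\mathbf{A}_{jk}=0$. A chiral Hamiltonian on $\mathcal{G}$ is a matrix of the form $\mathbf{H}=\tilde{\mathbf{D}}+\tilde{\mathbf{A}}$ with $\tilde{\mathbf{D}}$ an arbitrary real diagonal matrix and $\tilde{\mathbf{A}}$ a chiral adjacency matrix on $\mathcal{G}$. For a vertex $v$, $\underline{e}_v\in\mathbb{C}^n$ denotes the standard basis vector corresponding to $v$. A chiral Hamiltonian $\mathbf{H}$ on $\mathcal{G}$ generates a swift chiral quantum walk starting from $v$ if $|\underline{e}_v^\dagger e^{-i\mathbf{H}t}\underline{e}_v|^2=\cos^2(\sqrt{N}\,t)$ for all $t\ge 0$, where $N$ is the degree of $v$ in $\mathcal{G}$. For a chiral Hamiltonian $\mathbf{H}$ and the initial state $\underline{e}_v$, the quantum speed limit (for evolution to an orthogonal state) is $$\tau_{QSL}(\mathbf{H})=\max\left\{\frac{\pi}{2\,\Delta\mathbf{H}},\ \frac{\pi}{2(\langle\mathbf{H}\rangle-E_0)}\right\},$$ where $\langle\mathbf{H}\rangle=\underline{e}_v^\dagger\mathbf{H}\underline{e}_v$, $\Delta\mathbf{H}=\sqrt{\underline{e}_v^\dagger\mathbf{H}^2\underline{e}_v-\langle\mathbf{H}\rangle^2}$,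 and $E_0$ is the smallest eigenvalue of $\mathbf{H}$. *)

(* Defs.v *)
From HB Require Import structures.
From mathcomp Require Import all_boot all_order all_algebra.
From mathcomp Require Import spectral complex.
From mathcomp Require Import all_classical all_reals all_analysis.

Set Implicit Arguments.
Unset Strict Implicit.
Unset Printing Implicit Defensive.

Import Order.TTheory GRing.Theory Num.Theory.
Import numFieldNormedType.Exports.

Local Open Scope classical_set_scope.
Local Open Scope ring_scope.
Local Open Scope complex_scope.
Local Open Scope sesquilinear_scope.

(* The limit is taken in the (entrywise) topology of 'M[C]_n. *)
Definition mxexp (C : numFieldType) (n : nat) (M : 'M[C]_n) : 'M[C]_n :=
  lim (series (fun k : nat => (k`!%:R)^-1 *: M ^+ k) @ \oo).

(* A simple undirected graph on the vertex set 'I_n is given by a symmetric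
   and irreflexive relation e on 'I_n. *)

Definition degree (n : nat) (e : rel 'I_n) (v : 'I_n) : nat :=
  #|[set w | e v w]%SET|.

Definition connected_graph (n : nat) (e : rel 'I_n) : Prop :=
  forall x y : 'I_n, connect e x y.

Definition adjmx (R : realType) (n : nat) (e : rel 'I_n) : 'M[R[i]]_n :=
  \matrix_(j, k) (e j k)%:R.

Definition chiral_adjmx (R : realType) (n : nat) (e : rel 'I_n)
    (A : 'M[R[i]]_n) : Prop :=
  [/\ A \is hermsymmx,
      forall j k, adjmx R e j k = 1 -> `|A j k| = 1
    & forall j k, adjmx R e j k = 0 -> A j k = 0].

Definition chiral_hamiltonian (R : realType) (n : nat) (e : rel 'I_n)
    (H : 'M[R[i]]_n) : Prop :=
  exists (d : 'rV[R]_n) (A : 'M[R[i]]_n),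
    chiral_adjmx e A /\ H = diag_mx (map_mx (real_complex R) d) + A.

Definition basisv (R : realType) (n : nat) (v : 'I_n) : 'cV[R[i]]_n :=
  delta_mx v 0.

(* <psi| M |psi> *)
Definition braket (R : realType) (n : nat) (psi : 'cV[R[i]]_n)
    (M : 'M[R[i]]_n) : R[i] :=
  (psi ^t* *m M *m psi) 0 0.

Definition amplitude (R : realType) (n : nat) (H : 'M[R[i]]_n) (v : 'I_n)
    (t : R) : R[i] :=
  braket (basisv R v) (mxexp ((- 'i * t%:C) *: H)).

Definition swift (R : realType) (n : nat) (e : rel 'I_n) (v : 'I_n)
    (H : 'M[R[i]]_n) : Prop :=
  forall t : R, 0 <= t ->
    `|amplitude H v t| ^+ 2 =
      (cos (Num.sqrt (degree e v)%:R * t) ^+ 2)%:C.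

(* For H hermitian the expectations below are real numbers; complex.Re only
   moves them from R[i] to R. *)
Definition mean_energy (R : realType) (n : nat) (H : 'M[R[i]]_n)
    (v : 'I_n) : R :=
  complex.Re (braket (basisv R v) H).

Definition energy_spread (R : realType) (n : nat) (H : 'M[R[i]]_n)
    (v : 'I_n) : R :=
  Num.sqrt (complex.Re (braket (basisv R v) (H ^+ 2)) - mean_energy H v ^+ 2).

(* The smallest eigenvalue; for H hermitian all eigenvalues are real, and for
   0 < n there is a smallest one (otherwise the value is the default 0). *)
Definition ground_energy (R : realType) (n : nat) (H : 'M[R[i]]_n) : R :=
  xget 0 [set a : R | eigenvalue H a%:C /\
                      forall b : R, eigenvalue H b%:C -> a <= b].

(* When v has a neighbour and H is a chiral Hamiltonian, both denominators are
   positive, so that the convention x / 0 = 0 plays no role. *)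
Definition quantum_speed_limit (R : realType) (n : nat) (H : 'M[R[i]]_n)
    (v : 'I_n) : R :=
  Num.max (pi / (2 * energy_spread H v))
          (pi / (2 * (mean_energy H v - ground_energy H))).

(* Main.v *)
(* Let p be the spectral measure of H at e_v, carried by the eigenvalues x_j,
   with mean mu.  For every chiral H its variance is the degree N of v, so that
   pi / (2 Delta H) = tau_s always.  The amplitude at time t is the
   characteristic function of p; if it vanishes then
   sum_j p_j cos ((x_j - mu) t) = 0, and the inequality
   cos y >= pi / 4 - y ^ 2 / pi, with equality only for y = +- pi / 2, gives
   N t ^ 2 >= (pi / 2) ^ 2.  For the swift walk at t = tau_s there is equality,
   so p lives on mu +- sqrt N and charges both points because its mean is mu;
   hence E_0 <= mu - sqrt N. *)

Require Import Defs.
From mathcomp Require Import all_boot all_order all_algebra.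
From mathcomp Require Import spectral complex.
From mathcomp Require Import all_classical all_reals all_analysis.
From mathcomp Require Import ring lra.
Import Order.TTheory GRing.Theory Num.Theory.
Local Open Scope ring_scope.
Import numFieldNormedType.Exports.
Local Open Scope classical_set_scope.
Local Open Scope ring_scope.
Local Open Scope complex_scope.
Local Open Scope sesquilinear_scope.

(** * Exponential series of scalars and matrices *)

Lemma cvg_real_complex (R : realType) (u : nat -> R) (l : R) :
  u @ \oo --> l ->
  (fun n => (u n)%:C : (R[i] : numFieldType)) @ \oo --> (l%:C : (R[i] : numFieldType)).
Proof.
move=> /cvgrPdist_lt ul; apply/cvgrPdist_lt => e e0.
(* A positive element of [R[i]] is real, so the radius [e] can be compared in [R]. *)
have er : e = (complex.Re e)%:C by rewrite RRe_real // gtr0_real.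
have e0' : 0 < complex.Re e by rewrite er ltcR in e0.
near=> n.
rewrite -rmorphB /= normc_def /= expr0n addr0 sqrtr_sqr er ltcR.
near: n; exact: ul.
Unshelve. all: by end_near. Qed.

(** Partial sums of the matrix series are combinations of the [E j] weighted by scalar partial sums,
    so the limit is taken coefficient by coefficient. *)
Lemma mxexp_spectral_sum (C : numFieldType) (n m : nat) (M : 'M[C]_n)
    (x l : 'I_m -> C) (E : 'I_m -> 'M[C]_n) :
  (forall k, M ^+ k = \sum_j x j ^+ k *: E j) ->
  (forall j, series (fun k => (k`!%:R)^-1 * x j ^+ k) @ \oo --> l j) ->
  mxexp M = \sum_j l j *: E j.
Proof.
move=> ME xl; apply: cvg_lim; first exact: norm_hausdorff.
rewrite (_ : series _ = fun N =>
    \sum_j series (fun k => (k`!%:R)^-1 * x j ^+ k) N *: E j); last first.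
  apply/funext => N; rewrite /series /=.
  under eq_bigr do rewrite ME scaler_sumr.
  rewrite exchange_big /=; apply: eq_bigr => j _.
  by rewrite scaler_suml; apply: eq_bigr => k _; rewrite scalerA.
apply: cvg_big => [|j _]; first exact: add_continuous.
by apply: cvgZr_tmp; exact: xl.
Qed.

Lemma cvg_series_expNi (R : realType) (y : R) :
  series (fun k => (k`!%:R)^-1 * (- 'i * y%:C) ^+ k : (R[i] : numFieldType)) @ \oo -->
  ((cos y)%:C - 'i * (sin y)%:C : (R[i] : numFieldType)).
Proof.
have coefE k : (k`!%:R)^-1 * (- 'i * y%:C) ^+ k =
    (cos_coeff y k)%:C - 'i * (sin_coeff y k)%:C :> R[i].
  rewrite /cos_coeff /sin_coeff /= exprMn -rmorphXn /=.
  (* Even powers of [- 'i] are real and odd ones imaginary, which splits the exponential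
     coefficients into those of cosine and sine. *)
  have -> : (- 'i : R[i]) ^+ k =
      ((~~ odd k)%:R * (-1) ^+ k./2)%:C - 'i * ((odd k)%:R * (-1) ^+ k.-1./2)%:C.
    rewrite -[k in LHS]odd_double_half addnC exprD -muln2 mulnC exprM sqrrN sqr_i.
    case: (boolP (odd k)) => ok /=.
      have -> : k.-1./2 = k./2.
        by rewrite -{1}[k]odd_double_half ok /= doubleK.
      by rewrite mul0r mul1r expr1 rmorph0 rmorphXn rmorphN1 add0r mulrN mulrC.
    by rewrite mul1r mul0r expr0 mulr1 rmorph0 mulr0 subr0 rmorphXn rmorphN1.
  rewrite -!exprnP !rmorphM /= fmorphV /= !rmorph_nat.
  by ring.
rewrite (_ : series _ = fun N => (series (cos_coeff y) N)%:C -
    'i * (series (sin_coeff y) N)%:C); last first.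
  apply/funext => N; rewrite /series /= !rmorph_sum mulr_sumr -sumrB.
  by apply: eq_bigr => k _; exact: coefE.
have cvgcos := cvg_real_complex _ _ _ (@is_cvg_series_cos_coeff R y).
have cvgsin := cvg_real_complex _ _ _ (@is_cvg_series_sin_coeff R y).
rewrite cos.unlock sin.unlock.
exact: (cvgB cvgcos (cvgMl_tmp cvgsin)).
Qed.

(** * A sharp quadratic lower bound for the cosine *)

Lemma MVT_derive {R : realType} (f df : R -> R) (a b : R) :
  (forall x : R, is_derive x 1 f (df x)) -> a < b ->
  exists2 c, a < c < b & f b - f a = df c * (b - a).
Proof.
move=> fdf ab.
have fc : {within `[a, b], continuous f}.
  apply: continuous_subspaceT => x; apply: differentiable_continuous.
  by apply/derivable1_diffP; apply: ex_derive.
have [c cab fE] := MVT ab (fun x _ => fdf x) fc.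
by exists c => //; rewrite in_itv in cab.
Qed.

(** Jordan's inequality, by concavity: [h] vanishes at 0 and [pi / 2], so [h y <= 0] would give mean
    slopes that do not decrease across [y], although [cos] strictly decreases. *)
Lemma sin_gt_chord (R : realType) (y : R) :
  0 < y < pi / 2 -> 2 / pi * y < sin y.
Proof.
move=> /andP[y0 yp]; have pi0 := pi_gt0 R.
pose h (x : R) := sin x - 2 / pi * x.
have dh (x : R) : is_derive x 1 h (cos x - 2 / pi).
  apply: is_derive_eq.
  by rewrite /GRing.scale /= mulr1.
rewrite ltNge; apply/negP => hy.
have [a /andP[a0 ay] ha] := MVT_derive _ _ _ _ dh y0.
have [b /andP[yb bp] hb] := MVT_derive _ _ _ _ dh yp.
have h0 : h 0 = 0 by rewrite /h sin0 mulr0 subr0.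
have hp : h (pi / 2) = 0 by rewrite /h sin_pihalf mulrA divfK ?lt0r_neq0 // divff // subrr.
have hle0 : h y <= 0 by rewrite /h subr_le0.
have ca : cos a - 2 / pi <= 0.
  by rewrite -(pmulr_lle0 _ (_ : 0 < y - 0)) ?subr_gt0 // -ha h0 subr0.
have cb : 0 <= cos b - 2 / pi.
  by rewrite -(pmulr_lge0 _ (_ : 0 < pi / 2 - y)) ?subr_gt0 // -hb hp sub0r oppr_ge0.
have : cos b < cos a.
  by rewrite ltr_cos ?in_itv /= ?(lt_trans ay yb) //; apply/andP; split; lra.
by lra.
Qed.

(* The right-hand side is the tangent of x |-> cos (sqrt x) at (pi / 2) ^ 2,
   taken at x = y ^ 2. *)
Lemma cos_gt_quadratic (R : realType) (y : R) :
  `|y| != pi / 2 -> pi / 4 - y ^+ 2 / pi < cos y.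
Proof.
have pi0 := pi_gt0 R.
rewrite -cos_norm -[y ^+ 2]real_normK ?num_real //.
move: `|y| (normr_ge0 y) => {}y y0 yp.
pose g (x : R) := cos x + x * x / pi.
have dg (x : R) : is_derive x 1 g (2 / pi * x - sin x).
  apply: is_derive_eq.
  rewrite /GRing.scale /=; ring.
have gp : g (pi / 2) = pi / 4 by rewrite /g cos_pihalf add0r; move: (@pi R) pi0 => p p0; field; rewrite lt0r_neq0.
(* [g] decreases up to [pi / 2] by the chord bound and increases afterwards because
   [sin c <= 1 < 2 / pi * c], so its minimum is at [pi / 2]. *)
suff : g (pi / 2) < g y by rewrite gp /g -expr2; lra.
rewrite -subr_gt0.
case: (ltgtP y (pi / 2)) yp => // yp _.
  have [c /andP[yc cp]] := MVT_derive _ _ _ _ dg yp.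
  have : 2 / pi * c < sin c by apply: sin_gt_chord; apply/andP; split => //; lra.
  by move=> ? E; nra.
have [c /andP[pc cy] ->] := MVT_derive _ _ _ _ dg yp.
apply: mulr_gt0; last by rewrite subr_gt0.
have := sin_le1 c; have : 1 < 2 / pi * c.
  by rewrite mulrAC ltr_pdivlMr // mul1r; lra.
by lra.
Qed.

Lemma cos_ge_quadratic (R : realType) (y : R) :
  pi / 4 - y ^+ 2 / pi <= cos y.
Proof.
have [yp|/(cos_gt_quadratic R y)/ltW//] := eqVneq `|y| (pi / 2).
rewrite -cos_norm -[y ^+ 2]real_normK ?num_real // yp cos_pihalf.
rewrite -subr_ge0 (_ : _ - _ = 0) //; by move: (@pi R) (pi_gt0 R) => p p0; field; rewrite lt0r_neq0.
Qed.

(** * Spectral resolution and spectral measure of a hermitian matrix *)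

(** Unitary diagonalisation makes each [E j] a rank-one projector. The index runs over an
    eigenbasis, so repeated eigenvalues stay ungrouped. *)
Lemma spectral_resolution (C : numClosedFieldType) (n : nat) (H : 'M[C]_n) :
  H \is hermsymmx ->
  exists x : 'I_n -> C, exists E : 'I_n -> 'M[C]_n,
  [/\ forall j, x j \is Num.real,
      forall k, H ^+ k = \sum_j x j ^+ k *: E j,
      forall j v, 0 <= E j v v
    & forall a, eigenvalue H a <-> exists j, a = x j].
Proof.
move=> Hherm; have /orthomx_spectralP := hermitian_normalmx Hherm.
have dreal := hermitian_spectral_diag_real Hherm.
have Pu := spectral_unit H; have Punit := spectral_unitarymx H.
move: (spectralmx H) (spectral_diag H) dreal Pu Punit => P d dreal Pu Punit HE.
exists (fun j => d 0 j), (fun j => invmx P *m delta_mx j j *m P); split.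
- by move=> j; apply: (mxOverP dreal).
- move=> k.
  have -> : H ^+ k = invmx P *m diag_mx (\row_j d 0 j ^+ k) *m P.
    elim: k => [|k IHk].
      rewrite (_ : \row_j _ = const_mx 1); last by apply/rowP => j; rewrite !mxE.
      by rewrite diag_const_mx mulmx1 mulVmx.
    rewrite exprSr IHk HE -[_ * _]/(_ *m _) !mulmxA mulmxK //.
    congr (_ *m _); rewrite -!mulmxA mulmx_diag; congr (_ *m diag_mx _).
    by apply/rowP => j; rewrite !mxE exprSr.
  rewrite diag_mx_sum_delta mulmx_sumr mulmx_suml; apply: eq_bigr => j _.
  by rewrite !mxE -scalemxAr -scalemxAl.
- move=> j v.
  (* [delta_mx j j] factors as a column times a row, which turns the entry into the squared modulus
     of [P j v]. *)
  rewrite (invmx_unitary Punit) -(mul_delta_mx (0 : 'I_1)) mulmxA -mulmxA.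
  rewrite mxE big_ord1 -colE -rowE !mxE mulrC.
  exact: mul_conjC_ge0.
- move=> a; split => [/eigenvalueP[u uH u0]|[j ->]].
    (* [eigenvalue] refers to row vectors; [w] holds the coordinates of [u] in the eigenbasis, and
       any nonzero coordinate selects an index. *)
    pose w := u *m invmx P.
    have wd : w *m diag_mx d = a *: w.
      rewrite /w scalemxAl -uH HE !mulmxA mulmxK //.
    have w0 : w != 0.
      apply: contraNneq u0 => w0.
      by rewrite -[u](mulmxKV Pu) -/w w0 mul0mx.
    have [j wj] : exists j, w 0 j != 0.
      apply/existsP; apply: contraNT w0; rewrite negb_exists => /forallP w0.
      by apply/eqP/rowP => j; rewrite [RHS]mxE; apply/eqP; rewrite -[_ == _]negbK.
    clearbody w; exists j; move/rowP/(_ j): wd; rewrite mul_mx_diag !mxE mulrC.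
    by move=> /(mulIf wj).
  apply/eigenvalueP; exists (row j P).
    rewrite HE !mulmxA -row_mul mulmxV // -mulmxA -row_mul mul1mx.
    by rewrite mul_diag_mx; apply/rowP => i; rewrite !mxE.
  (* A zero row of [P] would contradict the unit diagonal of [P *m invmx P]. *)
  apply/negP => /eqP Pj0; have /rowP/(_ j) := congr1 (row j) (mulmxV Pu).
  by rewrite row_mul Pj0 mul0mx !mxE eqxx => /eqP; rewrite eq_sym oner_eq0.
Qed.

Lemma braket_basisv (R : realType) (n : nat) (M : 'M[R[i]]_n) (v : 'I_n) :
  braket (basisv R v) M = M v v.
Proof.
rewrite /braket /basisv trmx_delta (_ : map_mx _ _ = delta_mx 0 v).
  by rewrite -rowE -colE !mxE.
by rewrite map_delta_mx.
Qed.

Lemma ground_energy_le (R : realType) (n : nat) (H : 'M[R[i]]_n) (b : R) :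
  H \is hermsymmx -> eigenvalue H b%:C -> ground_energy H <= b.
Proof.
move=> Hherm Hb; rewrite /ground_energy.
case: xgetP => [a _ [_ /(_ _ Hb)]//|].
(* What remains is the default branch of [xget], refuted by exhibiting a smallest eigenvalue: the
   least [x j] over a finite index set, nonempty because of [b]. *)
have [x [E [xreal _ _ xeig]]] := spectral_resolution _ _ _ Hherm.
have [j0 _] := (xeig b%:C).1 Hb.
case: (@Order.TotalTheory.arg_minP _ _ _ j0 xpredT (fun j => complex.Re (x j)) isT) => j _ jmin.
have xjE : (complex.Re (x j))%:C = x j by rewrite RRe_real.
have xj_eig : eigenvalue H (complex.Re (x j))%:C.
  by rewrite xjE; apply/xeig; exists j.
have xj_min c : eigenvalue H c%:C -> complex.Re (x j) <= c.
  by case/xeig => i cx; have := jmin i isT; rewrite -cx.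
by move=> /(_ _ (conj xj_eig xj_min)).
Qed.

Lemma exp_scalemx (K : comPzRingType) (n : nat) (a : K) (M : 'M[K]_n) (k : nat) :
  (a *: M) ^+ k = a ^+ k *: M ^+ k.
Proof.
elim: k => [|k IHk]; first by rewrite !expr0 scale1r.
by rewrite !exprS IHk -[LHS]/(_ *m _) -scalemxAl -scalemxAr scalerA.
Qed.

(** The weight of [x j] is [E j v v], the squared overlap of the basis vector at [v] with an
    eigenvector. *)
Lemma spectral_measure (R : realType) (n : nat) (H : 'M[R[i]]_n) (v : 'I_n) :
  H \is hermsymmx ->
  exists x p : 'I_n -> R,
  [/\ forall j, 0 <= p j,
      forall k, (H ^+ k) v v = (\sum_j p j * x j ^+ k)%:C,
      forall t, amplitude H v t =
        (\sum_j p j * cos (x j * t))%:C - 'i * (\sum_j p j * sin (x j * t))%:C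
    & forall j, ground_energy H <= x j].
Proof.
move=> Hherm; have [x [E [xreal HE Ege0 xeig]]] := spectral_resolution _ _ _ Hherm.
exists (fun j => complex.Re (x j)), (fun j => complex.Re (E j v v)).
have xE j : (complex.Re (x j))%:C = x j by rewrite RRe_real.
have pE j : (complex.Re (E j v v))%:C = E j v v by rewrite RRe_real // ger0_real.
split.
- by move=> j; rewrite -lecR pE.
- move=> k; rewrite HE summxE rmorph_sum; apply: eq_bigr => j _.
  by rewrite mxE rmorphM rmorphXn /= xE pE mulrC.
- move=> t; rewrite /amplitude braket_basisv.
  rewrite (@mxexp_spectral_sum _ _ _ _ (fun j => - 'i * (complex.Re (x j) * t)%:C)
    (fun j => (cos (complex.Re (x j) * t))%:C - 'i * (sin (complex.Re (x j) * t))%:C) E).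
  + rewrite summxE !rmorph_sum mulr_sumr -sumrB; apply: eq_bigr => j _.
    by rewrite mxE !rmorphM /= pE; ring.
  + move=> k; rewrite exp_scalemx HE scaler_sumr; apply: eq_bigr => j _.
    by rewrite scalerA -exprMn rmorphM /= xE; congr (_ ^+ _ *: _); ring.
  + by move=> j; exact: cvg_series_expNi.
- by move=> j; apply: ground_energy_le => //; rewrite xE; apply/xeig; exists j.
Qed.

(** * Mean and variance of a chiral Hamiltonian at a vertex *)

Lemma chiral_hermsymmx (R : realType) (n : nat) (e : rel 'I_n) (H : 'M[R[i]]_n) :
  chiral_hamiltonian e H -> H \is hermsymmx.
Proof.
move=> [d [A [[Aherm _ _] ->]]].
move: Aherm; rewrite !is_hermitianmxE expr0 !scale1r => /eqP AE.
rewrite !raddfD /= -AE tr_diag_mx map_diag_mx; apply/eqP; congr (diag_mx _ + _).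
by apply/rowP => j; rewrite !mxE; apply/esym/CrealP; rewrite complex_real.
Qed.

Lemma chiral_diag_real (R : realType) (n : nat) (e : rel 'I_n)
    (H : 'M[R[i]]_n) (v : 'I_n) :
  irreflexive e -> chiral_hamiltonian e H -> H v v = (mean_energy H v)%:C.
Proof.
move=> e_irr [d [A [[_ _ A0] ->]]]; rewrite /mean_energy braket_basisv !mxE eqxx.
by rewrite A0 ?addr0 //= mxE e_irr.
Qed.

(** By hermiticity this entry is the squared norm of row [v]: each neighbour contributes 1 and the
    diagonal contributes the squared mean. *)
Lemma chiral_sqr_diag (R : realType) (n : nat) (e : rel 'I_n)
    (H : 'M[R[i]]_n) (v : 'I_n) :
  irreflexive e -> chiral_hamiltonian e H ->
  (H ^+ 2) v v = (mean_energy H v ^+ 2 + (degree e v)%:R)%:C.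
Proof.
move=> e_irr Hch; have := chiral_hermsymmx _ _ _ _ Hch.
rewrite is_hermitianmxE expr0 scale1r => /eqP HE.
rewrite -[H ^+ 2]/(H *m H) mxE (bigD1 v) //= (chiral_diag_real _ _ _ _ _ e_irr Hch).
rewrite rmorphD rmorphXn /= -expr2; congr (_ + _).
have [d [A [[_ A1 A0] HA]]] := Hch.
rewrite (eq_bigr (fun j => (e v j)%:R)); last first.
  move=> j jv; rewrite {2}HE !mxE -normCK HA !mxE eq_sym (negPf jv) add0r.
  case evj : (e v j); first by rewrite A1 ?expr1n // mxE evj.
  by rewrite A0 ?normr0 ?expr0n // mxE evj.
rewrite -natr_sum rmorph_nat; congr (_%:R).
rewrite /degree -sum1_card [RHS]big_mkcond [RHS](bigD1 v) //= inE e_irr add0n.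
by apply: eq_bigr => j _; rewrite inE; case: (e v j).
Qed.

Lemma energy_spread_chiral (R : realType) (n : nat) (e : rel 'I_n)
    (H : 'M[R[i]]_n) (v : 'I_n) :
  irreflexive e -> chiral_hamiltonian e H ->
  energy_spread H v = Num.sqrt (degree e v)%:R.
Proof.
move=> e_irr Hch; rewrite /energy_spread braket_basisv.
by rewrite (chiral_sqr_diag _ _ _ _ _ e_irr Hch) /= addrAC subrr add0r.
Qed.

(** * Vanishing amplitude against variance *)

Section VarianceBound.
Variables (R : realType) (n : nat) (x p : 'I_n -> R) (mu s t : R).
Hypotheses (p_ge0 : forall j, 0 <= p j) (p1 : \sum_j p j = 1)
  (px : \sum_j p j * x j = mu) (pxx : \sum_j p j * x j ^+ 2 = mu ^+ 2 + s)
  (pcos : \sum_j p j * cos (x j * t) = 0)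
  (psin : \sum_j p j * sin (x j * t) = 0).

Let y j := (x j - mu) * t.

(** The weighted slack in the quadratic cosine bound at the centred phase [y j]. *)
Let gap j := p j * (cos (y j) - (pi / 4 - y j ^+ 2 / pi)).

Let gap_ge0 j : 0 <= gap j.
Proof. by rewrite mulr_ge0 // subr_ge0 cos_ge_quadratic. Qed.

Let sum_gap : \sum_j gap j = s * t ^+ 2 / pi - pi / 4.
Proof.
(* The subtraction formula reduces the cosines to the two vanishing sums; the quadratic part only
   involves moments of order at most two. *)
have -> : \sum_j gap j =
    cos (mu * t) * (\sum_j p j * cos (x j * t)) +
    sin (mu * t) * (\sum_j p j * sin (x j * t)) +
    t ^+ 2 / pi * (\sum_j p j * x j ^+ 2) -
    2 * mu * t ^+ 2 / pi * (\sum_j p j * x j) +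
    (mu ^+ 2 * t ^+ 2 / pi - pi / 4) * (\sum_j p j).
  rewrite !mulr_sumr -!big_split -sumrB -big_split; apply: eq_bigr => j _ /=.
  by rewrite /gap /y mulrBl cosB; ring.
by rewrite p1 px pxx pcos psin; ring.
Qed.

Lemma sqr_time_ge : (pi / 2) ^+ 2 <= s * t ^+ 2.
Proof.
have : 0 <= \sum_j gap j by apply: sumr_ge0.
rewrite sum_gap subr_ge0 ler_pdivlMr ?pi_gt0 //.
by apply: le_trans; rewrite -subr_ge0 (_ : _ - _ = 0) //; move: (@pi R) => q; field.
Qed.

(** Equality makes every gap zero, so charged points have phase [pi / 2] or [- (pi / 2)]. Without
    the latter the mean phase would be [pi / 2], but centring makes it 0. *)
Lemma sqr_time_eq : s * t ^+ 2 = (pi / 2) ^+ 2 -> exists j, y j = - (pi / 2).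
Proof.
move=> st.
have gap0 j : gap j = 0.
  have : \sum_j gap j == 0.
    have pi0 := lt0r_neq0 (pi_gt0 R).
    by rewrite sum_gap st; apply/eqP; move: (@pi R) pi0 => q q0; field.
  by rewrite psumr_eq0 // => /allP/(_ j (mem_index_enum j))/eqP.
apply: contrapT => /forallNP yN.
have : \sum_j p j * y j = pi / 2.
  rewrite -[RHS]mul1r -[X in X * _]p1 mulr_suml; apply: eq_bigr => j _.
  have [->|pj] := eqVneq (p j) 0; first by rewrite !mul0r.
  congr (_ * _); apply/eqP; move/eqP: (gap0 j); rewrite mulf_eq0 (negPf pj) /=.
  apply: contraTT => yj; rewrite subr_eq0 gt_eqF // cos_gt_quadratic //.
  apply: contra yj; rewrite eqr_norml.
  by case/andP => /orP[//|/eqP/yN].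
have -> : \sum_j p j * y j = t * (\sum_j p j * x j - mu * \sum_j p j).
  by rewrite mulr_sumr -sumrB mulr_sumr; apply: eq_bigr => j _; rewrite /y; ring.
move=> /eqP; rewrite px p1 mulr1 subrr mulr0 lt_eqF //.
by rewrite divr_gt0 ?pi_gt0.
Qed.
End VarianceBound.

(** * Application to chiral walks *)

(** Gathers the data for the variance bounds: powers 0, 1, 2 of [H] give mass, mean and second
    moment, and the zero amplitude splits into real and imaginary parts. *)
Lemma chiral_moments (R : realType) (n : nat) (e : rel 'I_n)
    (H : 'M[R[i]]_n) (v : 'I_n) (t : R) :
  irreflexive e -> chiral_hamiltonian e H -> amplitude H v t = 0 ->
  exists x p : 'I_n -> R,
  [/\ forall j, ground_energy H <= x j,
      (forall j, 0 <= p j) /\ \sum_j p j = 1,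
      \sum_j p j * x j = mean_energy H v,
      \sum_j p j * x j ^+ 2 = mean_energy H v ^+ 2 + (degree e v)%:R
    & \sum_j p j * cos (x j * t) = 0 /\ \sum_j p j * sin (x j * t) = 0].
Proof.
move=> e_irr Hch; have Hherm := chiral_hermsymmx _ _ _ _ Hch.
have [x [p [p_ge0 pH ampE xmin]]] := spectral_measure _ _ _ v Hherm.
rewrite ampE -complexiE => /eqP; rewrite eq_complex /= => /andP[/eqP cos0 /eqP sin0].
exists x, p; split => //.
- split => //; have := pH 0%N; rewrite expr0 mxE eqxx => /(congr1 (@complex.Re R)) /= ->.
  by apply: eq_bigr => j _; rewrite expr0 mulr1.
- have := pH 1%N; rewrite expr1 (chiral_diag_real _ _ _ _ _ e_irr Hch).
  by case=> ->; apply: eq_bigr => j _; rewrite expr1.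
- by have := pH 2%N; rewrite (chiral_sqr_diag _ _ _ _ _ e_irr Hch) => -[->].
- by split; lra.
Qed.

Theorem theorem1 (R : realType) (n : nat) (e : rel 'I_n)
    (e_sym : symmetric e) (e_irr : irreflexive e) (e_conn : connected_graph e)
    (v : 'I_n) (deg_gt0 : (1 <= degree e v)%N)
    (Hs : 'M[R[i]]_n)
    (Hs_chiral : chiral_hamiltonian e Hs) (Hs_swift : swift e v Hs) :
  let tau_s : R := pi / (2 * Num.sqrt (degree e v)%:R) in
  [/\ amplitude Hs v tau_s = 0,
      quantum_speed_limit Hs v = tau_s,
      forall H : 'M[R[i]]_n, chiral_hamiltonian e H ->
        tau_s <= quantum_speed_limit H v
    & forall H : 'M[R[i]]_n, chiral_hamiltonian e H ->
        forall t : R, 0 < t -> amplitude H v t = 0 -> tau_s <= t].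
Proof.
move=> tau_s; set r : R := Num.sqrt (degree e v)%:R in tau_s *.
have r_gt0 : 0 < r by rewrite sqrtr_gt0 ltr0n.
have r2 : r ^+ 2 = (degree e v)%:R by rewrite sqr_sqrtr.
have tauE : r * tau_s = pi / 2.
  by rewrite /tau_s invfM mulrCA [_^-1 * _]mulrC mulVKf ?lt0r_neq0.
have tau_gt0 : 0 < tau_s by rewrite divr_gt0 ?pi_gt0 ?mulr_gt0.
have amp0 : amplitude Hs v tau_s = 0.
  apply/eqP; rewrite -normr_eq0 -sqrf_eq0 Hs_swift ?ltW // -/r tauE cos_pihalf.
  by rewrite expr0n.
split=> // [|H Hch|H Hch t t_gt0 ampt].
- rewrite /quantum_speed_limit (energy_spread_chiral _ _ _ _ _ e_irr Hs_chiral) -/r.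
  (* The spread term is already [tau_s]; it dominates once the ground energy lies at least [r] below
     the mean. *)
  apply/max_idPl; rewrite -/tau_s.
  have [x [p [xmin [p_ge0 p1] px pxx [pcos psin]]]] :=
    chiral_moments _ _ _ _ _ _ e_irr Hs_chiral amp0.
  have [|j yj] := sqr_time_eq _ _ _ _ _ _ _ p_ge0 p1 px pxx pcos psin.
    by rewrite -r2 -exprMn tauE.
  (* Since [pi / 2 = r * tau_s], cancelling [tau_s] in the phase equation locates [x j]. *)
  have xj : mean_energy Hs v - x j = r.
    by apply/(mulIf (lt0r_neq0 tau_gt0)); rewrite tauE; lra.
  rewrite /tau_s ler_pM2l ?pi_gt0 // lef_pV2 ?posrE ?mulr_gt0 //; have := xmin j; lra.
- rewrite /quantum_speed_limit (energy_spread_chiral _ _ _ _ _ e_irr Hch) -/r.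
  by rewrite le_max lexx.
- have [x [p [_ [p_ge0 p1] px pxx [pcos psin]]]] :=
    chiral_moments _ _ _ _ _ _ e_irr Hch ampt.
  have := sqr_time_ge _ _ _ _ _ _ _ p_ge0 p1 px pxx pcos psin.
  (* The bound now reads [(r * tau_s) ^+ 2 <= (r * t) ^+ 2], with nonnegative bases. *)
  rewrite -r2 -exprMn -tauE ler_pXn2r ?nnegrE ?(ltW (mulr_gt0 _ _)) //.
  by rewrite ler_pM2l.
Qed.
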